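(* Let $m,n$ be coprime positive integers and $r\geq 1$. The character varieties $\mathcal X_r$, $\tilde{\mathcal X}_r$ and $\bar{\mathcal X}_r$ of the torus knot group $\langle x,y\mid x^n=y^m\rangle$ into $\mathrm{SL}(r,\mathbb C)$, $\mathrm{GL}(r,\mathbb C)$ and $\mathrm{PGL}(r,\mathbb C)$, respectively, are connected.
   Context: For $G=\mathrm{SL}(r,\mathbb C)$, $\mathrm{GL}(r,\mathbb C)$ or $\mathrm{PGL}(r,\mathbb C)$ and $\Gamma=\langle x,y\mid x^n=y^m\rangle$, let $R(\Gamma,G)=\{(A,B)\in G^2\mid A^n=B^m\}$, an affine algebraic set on which $G$ acts by simultaneous conjugation. The character variety is the affine GIT quotient $R(\Gamma,G)/\!/G$; it is denoted $\mathcal X_r$, $\tilde{\mathcal X}_r$, $\bar{\mathcal X}_r$ respectively. *)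

(* Defs.v *)
From HB Require Import structures.
From mathcomp Require Import all_boot all_order all_algebra.
From mathcomp Require Import complex ring_quotient generic_quotient.
From mathcomp Require Import all_classical all_reals all_analysis.

Set Implicit Arguments.
Unset Strict Implicit.
Unset Printing Implicit Defensive.

Import GRing.Theory.

Local Open Scope classical_set_scope.
Local Open Scope ring_scope.
Local Open Scope quotient_scope.

(* [idealr_closed] includes [1 \notin prime_pred]. *)
Record Spec (A : comNzRingType) := MkSpec {
  prime_pred :> A -> bool;
  prime_pred_ideal : idealr_closed prime_pred;
  prime_pred_prime : prime_idealr_closed prime_pred }.

HB.instance Definition _ (A : comNzRingType) := gen_eqMixin (Spec A).
HB.instance Definition _ (A : comNzRingType) := gen_choiceMixin (Spec A).

Section Zariski.
Variable A : comNzRingType.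

Definition zariski_zeros (E : set A) : set (Spec A) :=
  [set p : Spec A | forall f, E f -> f \in prime_pred p].

Definition zariski_open (U : set (Spec A)) : Prop :=
  exists E : set A, U = ~` zariski_zeros E.

Lemma zariski_openT : zariski_open setT.
Proof.
exists [set 1]; apply/seteqP; split=> // p _ /(_ 1 erefl).
by case: (prime_pred_ideal p) => _ /negP.
Qed.

Lemma zariski_openI : setI_closed zariski_open.
Proof.
move=> _ _ [E ->] [F ->]; exists [set h | exists f g, [/\ E f, F g & h = f * g]].
apply/seteqP; split=> p.
  case=> /existsNP[f /not_implyP[Ef /negP pf]].
  move=> /existsNP[g /not_implyP[Fg /negP pg]] pEF.
  have /prime_pred_prime : f * g \in prime_pred p by apply: pEF; exists f, g.
  by rewrite (negbTE pf) (negbTE pg).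
case: (prime_pred_ideal p) => p0 _ pM.
move=> npEF; split=> pE; apply: npEF => _ [f [g [Ef Fg ->]]].
  by rewrite mulrC -[g * f]addr0 pM// pE.
by rewrite -[f * g]addr0 pM// pE.
Qed.

Lemma zariski_open_bigcup (I : Type) (U : I -> set (Spec A)) :
  (forall i, zariski_open (U i)) -> zariski_open (\bigcup_i U i).
Proof.
move=> /choice[E UE]; exists (\bigcup_i E i); apply/seteqP; split=> p.
  by case=> i _; rewrite UE => npE pE; apply: npE => f Ef; apply: pE; exists i.
apply: contra_notP => nU f [i _ Ef].
apply: contrapT => npf; apply: nU; exists i => //.
by rewrite UE => pE; apply: npf; exact: pE.
Qed.

HB.instance Definition _ := isOpenTopological.Build (Spec A)
  zariski_openT zariski_openI zariski_open_bigcup.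

End Zariski.

Section FunctionAlgebras.
Variables (K : comNzRingType) (T : Type).

Definition subalgebra_of_functions (S : set (T -> K)) : Prop :=
  (forall c : K, S (cst c)) /\
  (forall f g, S f -> S g -> S (f \- g) /\ S (f \* g)).

Definition generated_algebra (E : set (T -> K)) : set (T -> K) :=
  smallest subalgebra_of_functions E.

Lemma generated_algebraP E : subalgebra_of_functions (generated_algebra E).
Proof.
split=> [c S [[Sc _] _]|f g Ef Eg]; first exact: Sc.
by split=> S [[Sc SBM] ES]; have [] := SBM f g;
  [exact: Ef | exact: Eg | | exact: Ef | exact: Eg |].
Qed.

End FunctionAlgebras.

Section CharacterVariety.
Variables (K : fieldType) (G : groupType).
(* An affine algebraic group is given by its group of points [G] together with
   its algebra [O] of regular functions. *)
Variables (O : set (G -> K)) (n m : nat).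

(* Pairs [(A, B)] with [A ^+ n = B ^+ m], i.e. representations of the torus
   knot group [<x, y | x ^+ n = y ^+ m>] in [G]. *)
Definition is_rep (p : G * G) : bool := (p.1 ^+ n == p.2 ^+ m)%g.

Definition repvar := {p : G * G | is_rep p}.

HB.instance Definition _ := Choice.on repvar.

Fact is_rep1 : is_rep (1, 1)%g.
Proof. by rewrite /is_rep !expg1n. Qed.
HB.instance Definition _ := isPointed.Build repvar (exist _ (1, 1)%g is_rep1).

Fact is_repJ (g : G) (p : repvar) :
  is_rep (g * (val p).1 * g^-1, g * (val p).2 * g^-1)%g.
Proof.
have conjE (h : G) : (g * h * g^-1 = h ^ g^-1)%g by rewrite conjgE invgK mulgA.
by case: p => -[a b] /= /eqP ab; rewrite /is_rep/= !conjE -!conjXg ab.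
Qed.
Definition repvarJ (g : G) (p : repvar) : repvar :=
  exist _ (g * (val p).1 * g^-1, g * (val p).2 * g^-1)%g (is_repJ g p).

(* The regular functions on [G * G] are generated by those of the two factors;
   those on the closed subset [repvar] are their restrictions. *)
Definition repvar_regular : set (repvar -> K) :=
  generated_algebra
    ([set (fun p : repvar => f (val p).1) | f in O] `|`
     [set (fun p : repvar => f (val p).2) | f in O]).

Definition repvar_invariant : {pred repvar -> K} :=
  [pred f | `[< repvar_regular f /\ forall g p, f (repvarJ g p) = f p >]].

Fact repvar_invariant_subring : subring_closed repvar_invariant.
Proof.
have [Oc OBM] := generated_algebraP
  ([set (fun p : repvar => f (val p).1) | f in O] `|`
   [set (fun p : repvar => f (val p).2) | f in O]).
split; first by apply/asboolP; split => //; exact: Oc.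
- move=> f g /asboolP[Of Jf] /asboolP[Og Jg]; apply/asboolP; split.
    exact: (OBM f g Of Og).1.
  by move=> h p; rewrite /= /GRing.add/= /GRing.opp/= Jf Jg.
- move=> f g /asboolP[Of Jf] /asboolP[Og Jg]; apply/asboolP; split.
    exact: (OBM f g Of Og).2.
  by move=> h p; rewrite /GRing.mul/= Jf Jg.
Qed.

HB.instance Definition _ :=
  GRing.isSubringClosed.Build _ repvar_invariant repvar_invariant_subring.

Record invariant_ring := InvariantRing {
  invariant_fun :> repvar -> K;
  invariant_funP : invariant_fun \in repvar_invariant }.

HB.instance Definition _ := [isSub for invariant_fun].
HB.instance Definition _ := [Choice of invariant_ring by <:].
HB.instance Definition _ :=
  [SubChoice_isSubComNzRing of invariant_ring by <:].

(* The affine GIT quotient: the spectrum, with its Zariski topology, of the ring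
   of regular functions on [repvar] invariant under simultaneous conjugation. *)
Definition charvar := Spec invariant_ring.

HB.instance Definition _ := Topological.on charvar.

End CharacterVariety.

Section GL.
Variables (K : fieldType) (r : nat).

Record GL := MkGL { GLmx :> 'M[K]_r; GLmx_unit : GLmx \in unitmx }.

HB.instance Definition _ := [isSub for GLmx].
HB.instance Definition _ := [Choice of GL by <:].

Fact GL_mul_subproof (A B : GL) : (A : 'M[K]_r) *m B \in unitmx.
Proof. by rewrite unitmx_mul !GLmx_unit. Qed.
Definition GL_mul A B := MkGL (GL_mul_subproof A B).

Definition GL_one := MkGL (unitmx1 K r).

Fact GL_inv_subproof (A : GL) : invmx (A : 'M[K]_r) \in unitmx.
Proof. by rewrite unitmx_inv GLmx_unit. Qed.
Definition GL_inv A := MkGL (GL_inv_subproof A).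

Fact GL_mulA : associative GL_mul.
Proof. by move=> A B C; apply: val_inj; rewrite /= mulmxA. Qed.
Fact GL_mul1 : left_id GL_one GL_mul.
Proof. by move=> A; apply: val_inj; rewrite /= mul1mx. Qed.
Fact GL_1mul : right_id GL_one GL_mul.
Proof. by move=> A; apply: val_inj; rewrite /= mulmx1. Qed.
Fact GL_mulV : left_inverse GL_one GL_inv GL_mul.
Proof. by move=> A; apply: val_inj; rewrite /= mulVmx ?GLmx_unit. Qed.
Fact GL_Vmul : right_inverse GL_one GL_inv GL_mul.
Proof. by move=> A; apply: val_inj; rewrite /= mulmxV ?GLmx_unit. Qed.

HB.instance Definition _ :=
  isGroup.Build GL GL_mulA GL_mul1 GL_1mul GL_mulV GL_Vmul.

Definition GL_regular : set (GL -> K) :=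
  generated_algebra
    ([set f | exists i j, f = fun A : GL => (A : 'M[K]_r) i j] `|`
     [set fun A : GL => (\det (A : 'M[K]_r))^-1]).

End GL.

Section SL.
Variables (K : fieldType) (r : nat).

Definition unimodular : {pred GL K r} :=
  [pred A : GL K r | \det (A : 'M[K]_r) == 1].

Fact unimodular_group : group_closed unimodular.
Proof.
split; first by rewrite inE/= det1.
move=> A B; rewrite !inE/= => /eqP A1 /eqP B1.
by rewrite det_mulmx det_inv A1 B1 invr1 mulr1.
Qed.

Record SL := MkSL { SLmx :> GL K r; SLmx_det : SLmx \in unimodular }.

HB.instance Definition _ := [isSub for SLmx].
HB.instance Definition _ := [Choice of SL by <:].
HB.instance Definition _ := SubChoice_isSubGroup.Build _ _ SL unimodular_group.

Definition SL_regular : set (SL -> K) :=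
  generated_algebra [set f | exists i j, f = fun A : SL => (A : 'M[K]_r) i j].

End SL.

Section PGL.
Variables (K : fieldType) (r : nat).

Definition proportional (A B : GL K r) : bool :=
  `[< exists2 c : K, c != 0 & (A : 'M[K]_r) = c *: (B : 'M[K]_r) >].

Fact proportional_equiv : equiv_class_of proportional.
Proof.
split=> [A|A B|B A C].
- by apply/asboolP; exists 1; rewrite ?oner_eq0 ?scale1r.
- by apply/asboolP/asboolP=> -[c c0 AB]; exists c^-1; rewrite ?invr_eq0//;
    rewrite AB scalerA mulVf// scale1r.
- move=> /asboolP[c c0 AB] /asboolP[d d0 BC]; apply/asboolP.
  by exists (c * d); rewrite ?mulf_neq0// AB BC scalerA.
Qed.
Canonical proportional_equivRel := EquivRelPack proportional_equiv.

Definition PGL := {eq_quot proportional}.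

HB.instance Definition _ := EqQuotient.on PGL.
HB.instance Definition _ := Choice.on PGL.

Definition PGL_one : PGL := \pi_PGL 1%g.
Definition PGL_mul (a b : PGL) : PGL := \pi_PGL (repr a * repr b)%g.
Definition PGL_inv (a : PGL) : PGL := \pi_PGL (repr a)^-1%g.

Fact PGL_pi_eq (A B : GL K r) :
  (exists2 c : K, c != 0 & (A : 'M[K]_r) = c *: (B : 'M[K]_r)) ->
  \pi_PGL A = \pi_PGL B.
Proof. by move=> AB; apply/eqP; rewrite piE; apply/asboolP. Qed.

Fact PGL_reprP (A : GL K r) :
  exists2 c : K, c != 0 & (repr (\pi_PGL A) : 'M[K]_r) = c *: (A : 'M[K]_r).
Proof.
suff: proportional (repr (\pi_PGL A)) A by move=> /asboolP.
by have := eqxx (\pi_PGL A); rewrite -{1}[\pi_PGL A]reprK piE.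
Qed.

Fact PGL_piM (A B : GL K r) :
  PGL_mul (\pi_PGL A) (\pi_PGL B) = \pi_PGL (A * B)%g.
Proof.
have [[c c0 Ac] [d d0 Bd]] := (PGL_reprP A, PGL_reprP B).
apply: PGL_pi_eq; exists (c * d); first by rewrite mulf_neq0.
by rewrite /= Ac Bd -scalemxAl -scalemxAr scalerA.
Qed.

Fact PGL_piV (A : GL K r) : PGL_inv (\pi_PGL A) = \pi_PGL A^-1%g.
Proof.
have [c c0 Ac] := PGL_reprP A.
apply: PGL_pi_eq; exists c^-1; first by rewrite invr_eq0.
by rewrite /= Ac invmxZ// -Ac GLmx_unit.
Qed.

Fact PGL_mulA : associative PGL_mul.
Proof.
move=> a b c; rewrite -[a]reprK -[b]reprK -[c]reprK.
move: (repr a) (repr b) (repr c) => A B C.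
by rewrite (PGL_piM B C) (PGL_piM A B) (PGL_piM A) PGL_piM mulgA.
Qed.
Fact PGL_mul1 : left_id PGL_one PGL_mul.
Proof.
by move=> a; rewrite -[a]reprK; move: (repr a) => A; rewrite PGL_piM mul1g.
Qed.
Fact PGL_1mul : right_id PGL_one PGL_mul.
Proof.
by move=> a; rewrite -[a]reprK; move: (repr a) => A; rewrite PGL_piM mulg1.
Qed.
Fact PGL_mulV : left_inverse PGL_one PGL_inv PGL_mul.
Proof.
by move=> a; rewrite -[a]reprK; move: (repr a) => A; rewrite PGL_piV PGL_piM mulVg.
Qed.
Fact PGL_Vmul : right_inverse PGL_one PGL_inv PGL_mul.
Proof.
by move=> a; rewrite -[a]reprK; move: (repr a) => A; rewrite PGL_piV PGL_piM mulgV.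
Qed.

HB.instance Definition _ :=
  isGroup.Build PGL PGL_mulA PGL_mul1 PGL_1mul PGL_mulV PGL_Vmul.

(* The coordinate ring of [PGL = GL / K^*] is the ring of regular functions on
   [GL] invariant under scaling, i.e. those which factor through [PGL]. *)
Definition PGL_regular : set (PGL -> K) :=
  [set f : PGL -> K | GL_regular (fun A : GL K r => f (\pi_PGL A))].

End PGL.

Definition SL_charvar (R : realType) (r n m : nat) :=
  charvar (@SL_regular R[i] r) n m.
Definition GL_charvar (R : realType) (r n m : nat) :=
  charvar (@GL_regular R[i] r) n m.
Definition PGL_charvar (R : realType) (r n m : nat) :=
  charvar (@PGL_regular R[i] r) n m.

HB.instance Definition _ R r n m := Topological.on (@SL_charvar R r n m).
HB.instance Definition _ R r n m := Topological.on (@GL_charvar R r n m).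
HB.instance Definition _ R r n m := Topological.on (@PGL_charvar R r n m).

(* Main.v *)
Require Import Defs.
From mathcomp Require Import all_boot all_order all_algebra.
From mathcomp Require Import all_classical all_reals all_analysis.
From mathcomp Require Import ring separable complex ring_quotient.
From mathcomp Require Import generic_quotient.

(** The spectrum of a ring is disconnected only when the ring has, modulo its
nilradical, an idempotent other than 0 and 1 ([Spec_connected]).  The ring of
invariants consists of functions on the set of representations, and evaluation
at a representation is a point of the spectrum, so such an idempotent would be
a non-constant regular function with values in {0, 1} ([charvar_connected]).
It is therefore enough to move from any representation to any other along
chains of rational curves: a rational function of one variable that takes only
the values 0 and 1 is constant ([rational_idempotent_const]).  The curves used
live in the representation variety itself, before any quotient is taken.

For SL, let A ^+ n = B ^+ m = C.  If C is not scalar, one of its eigenspaces is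
a proper subspace stable under A and B; in an adapted basis both matrices are
block triangular, and shrinking the off-diagonal blocks to 0 moves the pair to
a block diagonal one, where induction on the size applies.  If C is scalar,
then A and B are diagonalizable, and, since every conjugate of A still has n-th
power C and every conjugate of B still has m-th power C, they may be conjugated
independently until both are diagonal ([linked_diag]).  This is where a pair is
moved off its isomorphism class.  For diagonal pairs, coprimality of m and n
parametrizes the curve a ^+ n = b ^+ m as (s ^+ m, s ^+ n), and the
parameters s_i are joined to 1 inside the torus where their product is 1
([linked_diag1]).

In the induction the blocks do not have determinant 1, so the statement is
proved for pairs with any prescribed determinants; that the determinants stay
constant along every curve is what makes the outcome usable for SL.

A GL representation is (c ^+ m *: A, c ^+ n *: B) for some c != 0 and some SL
representation (A, B), and moving c to 1 reduces GL to SL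
([GL_idempotent_const]).  Every PGL representation lifts to GL, the scalar by
which A ^+ n and B ^+ m differ being absorbed in A by extracting an n-th root
([PGL_idempotent_const]). *)

Set Implicit Arguments.
Unset Strict Implicit.
Unset Printing Implicit Defensive.

Import GRing.Theory Num.Theory.

Local Open Scope classical_set_scope.
Local Open Scope ring_scope.

(** * Connectedness of a prime spectrum *)

Section SpecConnected.
Variable A : comNzRingType.

(** The shape of [idealr_closed] for sets that are not given by a boolean
predicate. *)
Definition proper_ideal_set (J : set A) : Prop :=
  [/\ J 0, ~ J 1 & forall a u v, J u -> J v -> J (a * u + v)].

Lemma Spec_proper_ideal_set (p : Spec A) :
  proper_ideal_set [set x | x \in prime_pred p].
Proof.
by case: (prime_pred_ideal p) => p0 /negP p1 pM; split => // a u v; exact: pM.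
Qed.

(** Krull: an ideal maximal among the proper ones above J, given by Zorn's
lemma, is prime. *)
Lemma prime_above (J : set A) :
  proper_ideal_set J -> exists p : Spec A, forall x, J x -> x \in prime_pred p.
Proof.
move=> Jp.
(* Taking the union with J makes the empty chain admissible. *)
pose P X := proper_ideal_set (X `|` J).
have [F FP Ftot|M [PM Mmax]] := @Zorn_bigcup A P.
  have [F0|/set0P[X0 FX0]] := eqVneq F set0.
    by rewrite /P F0 bigcup_set0 set0U.
  split=> [|[[X FX X1]|J1]|a u v].
  - by right; have [] := Jp.
  - by have [_ + _] := FP _ FX; apply; left.
  - by have [_ + _] := Jp; apply.
  have up x : (\bigcup_(X in F) X `|` J) x -> exists2 X, F X & (X `|` J) x.
    by case=> [[X FX Xx]|Jx]; [exists X => //; left|exists X0 => //; right].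
  move=> /up[X FX Xu] /up[Y FY Yv].
  wlog XY : / exists2 Z, F Z & (Z `|` J) u /\ (Z `|` J) v.
    apply; have [XY|YX] := Ftot _ _ FX FY.
      by exists Y => //; split=> //; case: Xu => [/XY|]; [left|right].
    by exists X => //; split=> //; case: Yv => [/YX|]; [left|right].
  have [Z FZ [Zu Zv]] := XY.
  have [_ _ /(_ a _ _ Zu Zv)[Zw|Jw]] := FP _ FZ; last by right.
  by left; exists Z.
pose N := M `|` J.
have [N0 N1 NM] : proper_ideal_set N := PM.
have NMl a x : N x -> N (a * x) by move=> Nx; rewrite -[_ * _]addr0; exact: NM.
have Ntop y : ~ N y -> exists a x, N x /\ 1 = a * y + x.
  move=> Ny; apply: contrapT => no1.
  pose L := [set z | exists a x, N x /\ z = a * y + x].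
  have NL : N `<=` L by move=> x Nx; exists 0, x; rewrite mul0r add0r.
  have Ly : L y by exists 1, 0; rewrite mul1r addr0.
  apply: (Mmax L).
    split; first by move=> x Mx; apply: NL; left.
    by move=> /(_ y Ly) My; apply: Ny; left.
  rewrite /P.
  have -> : L `|` J = L by apply/setUidl => x Jx; apply: NL; right.
  split; [exact: NL| by move=> [a [x [? ?]]]; apply: no1; exists a, x|].
  move=> b _ _ [a1 [x1 [N1x ->]]] [a2 [x2 [N2x ->]]].
  exists (b * a1 + a2), (b * x1 + x2); split; first exact: NM.
  by rewrite mulrDr mulrDl mulrA addrACA.
have Nideal : idealr_closed (fun x => `[< N x >]).
  split; [exact/asboolP|exact/asboolP|].
  by move=> a u v /asboolP Nu /asboolP Nv; apply/asboolP; exact: NM.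
have Nprime : prime_idealr_closed (fun x => `[< N x >]).
  move=> u v /asboolP Nuv; apply/orP.
  have [Nu|/Ntop[a [x [Nx ax]]]] := pselect (N u).
    by left; apply/asboolP.
  right; apply/asboolP; rewrite -[v]mul1r ax mulrDl -mulrA [x * v]mulrC.
  by apply: NM => //; exact: NMl.
by exists (MkSpec Nideal Nprime) => x Jx; apply/asboolP; right.
Qed.

(** A clopen set is the zero set of some F and its complement the zero set of
some E.  The two have no common zero, so by [prime_above] the radicals of E and
F contain e and f with e + f = 1; every prime contains e * f. *)
Lemma Spec_connected :
  (forall a : A, (forall p : Spec A, a * (1 - a) \in prime_pred p) ->
     a = 0 \/ a = 1) ->
  connected [set: Spec A].
Proof.
move=> idem B [b Bb] [_ [E ->]]; rewrite setTI => BE [C +].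
rewrite setTI => /[swap] <-.
rewrite -openC => -[F BF].
pose rad (G : set A) : set A :=
  [set a | forall p : Spec A, zariski_zeros G p -> a \in prime_pred p].
have radS G : G `<=` rad G by move=> a Ga p; apply.
have radM G a u v : rad G u -> rad G v -> rad G (a * u + v).
  move=> Gu Gv p Gp; have [_ _ pM] := Spec_proper_ideal_set p.
  by apply: pM; [exact: Gu|exact: Gv].
have rad0 G : rad G 0 by move=> p _; have [] := Spec_proper_ideal_set p.
have prime1 p : zariski_zeros E p \/ zariski_zeros F p.
  have [Bp|nBp] := pselect (B p).
    right; apply: contrapT => nFp; suff : (~` B) p by [].
    by rewrite BF.
  by left; apply: contrapT => nEp; apply: nBp; rewrite BE.
have disj p : zariski_zeros E p -> zariski_zeros F p -> False.
  move=> Ep Fp; have : (~` B) p by rewrite BE; apply.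
  by rewrite BF; apply.
have [e [f [radE radF ef]]] : exists e f, [/\ rad E e, rad F f & 1 = e + f].
  apply: contrapT => no1.
  pose J := [set x | exists e f, [/\ rad E e, rad F f & x = e + f]].
  have /prime_above[p pJ] : proper_ideal_set J.
    split; [by exists 0, 0; rewrite addr0|by []|].
    move=> a _ _ [e [f [Ee Ff ->]]] [e' [f' [Ee' Ff' ->]]].
    exists (a * e + e'), (a * f + f').
    by split; [exact: radM|exact: radM|rewrite mulrDr addrACA].
  apply: (disj p) => x Gx; apply: pJ.
    by exists x, 0; rewrite addr0; split=> //; exact: radS.
  by exists 0, x; rewrite add0r; split=> //; exact: radS.
have fE : f = 1 - e by rewrite ef addrC addKr.
have [p|e0|e1] := idem e.
- rewrite -fE; have [p0 _ pM] := Spec_proper_ideal_set p.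
  have [Ep|Fp] := prime1 p.
    by rewrite mulrC -[_ * _]addr0; apply: pM => //; exact: radE.
  by rewrite -[_ * _]addr0; apply: pM => //; exact: radF.
- exfalso; have [_ + _] := Spec_proper_ideal_set b; apply.
  rewrite ef e0 add0r; apply: radF.
  apply: contrapT => nFb; suff : (~` B) b by [].
  by rewrite BF.
- apply/seteqP; split=> // p _; rewrite BE => Ep.
  by have [_ + _] := Spec_proper_ideal_set p; apply; rewrite /= -e1; exact: radE.
Qed.

End SpecConnected.

(** * Rational functions of one variable *)

Section RationalCurves.
Variable K : numClosedFieldType.

(** Functions that are rational with a power of q as denominator; their values
at the zeros of q are arbitrary. *)
Definition rational_on (q : {poly K}) : set (K -> K) :=
  [set h | exists (p : {poly K}) k,
    forall t, q.[t] != 0 -> h t = p.[t] / q.[t] ^+ k].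

Lemma rational_subalgebra q : subalgebra_of_functions (rational_on q).
Proof.
split=> [c|f g [p [k fE]] [p' [k' gE]]].
  by exists c%:P, 0 => t _; rewrite hornerC divr1.
split.
- exists (p * q ^+ k' - p' * q ^+ k), (k + k')%N => t qt.
  rewrite /= fE// gE// !hornerE exprD.
  have := expf_neq0 k qt; have := expf_neq0 k' qt.
  by move: (_ ^+ k) (_ ^+ k') => u v u0 v0; field; rewrite u0 v0.
- exists (p * p'), (k + k')%N => t qt.
  by rewrite /= fE// gE// hornerM exprD invfM mulrACA.
Qed.

Lemma rationalC q c : rational_on q (fun=> c).
Proof. exact: (rational_subalgebra q).1. Qed.

Lemma rationalM q f g : rational_on q f -> rational_on q g -> rational_on q (f \* g).
Proof. by move=> fr gr; exact: ((rational_subalgebra q).2 f g fr gr).2. Qed.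

Lemma rationalD q f g : rational_on q f -> rational_on q g -> rational_on q (f \+ g).
Proof.
move=> fr gr; have B := fun f g fr gr => ((rational_subalgebra q).2 f g fr gr).1.
have -> : f \+ g = f \- (cst 0 \- g) by apply/funext => t; rewrite /= sub0r opprK.
by apply: (B) => //; apply: (B) => //; exact: rationalC.
Qed.

Lemma rational_sum q (I : Type) (s : seq I) (F : I -> K -> K) :
  (forall i, rational_on q (F i)) -> rational_on q (fun t => \sum_(i <- s) F i t).
Proof.
move=> Fr; elim: s => [|i s IHs].
  by under eq_fun do rewrite big_nil; exact: rationalC.
by under eq_fun do rewrite big_cons; exact: rationalD.
Qed.

Lemma rational_horner q p : rational_on q (horner p).
Proof. by exists p, 0 => t _; rewrite expr0 divr1. Qed.

Lemma rationalV q : rational_on q (fun t => (q.[t])^-1).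
Proof. by exists 1, 1%N => t _; rewrite hornerC mul1r. Qed.

Lemma rational_mull q q' h : rational_on q h -> rational_on (q' * q) h.
Proof.
move=> [p [k hE]]; exists (q' ^+ k * p), k => t; rewrite hornerM => qt.
move: (qt); rewrite mulf_eq0 => /norP[q't ?].
by rewrite hE// hornerM horner_exp exprMn invfM mulrACA divff ?mul1r// expf_neq0.
Qed.

Lemma poly_eq0_horner (p : {poly K}) : (forall t, p.[t] = 0) -> p = 0.
Proof.
move=> p0; apply/eqP; apply/negP => /negP pn0.
have := max_poly_roots (rs := [seq i%:R | i <- iota 0 (size p)]) pn0.
rewrite size_map size_iota ltnn => max_roots.
suff : false by []; apply: max_roots.
  by apply/allP => t _; apply/rootP.
rewrite map_inj_uniq ?iota_uniq// => i j /eqP.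
by rewrite eqr_nat => /eqP.
Qed.

(** Writing h as p / q ^+ k, the polynomial q * p * (p - q ^+ k) vanishes
everywhere, hence is 0, so that p = 0 or p = q ^+ k. *)
Lemma rational_idempotent_const q h : rational_on q h ->
  (forall t, q.[t] != 0 -> h t * h t = h t) ->
  forall a b, q.[a] != 0 -> q.[b] != 0 -> h a = h b.
Proof.
move=> [p [k hE]] hh a b qa qb.
have q0 : q != 0 by apply: contra_neq qa => ->; rewrite horner0.
have qe i t : q.[t] != 0 -> q.[t] ^+ i != 0 by move=> ?; rewrite expf_neq0.
have /eqP : q * (p * (p - q ^+ k)) = 0.
  apply: poly_eq0_horner => t; rewrite !hornerM hornerD hornerN horner_exp.
  have [->|qt] := eqVneq q.[t] 0; first by rewrite mul0r.
  have pE : p.[t] = h t * q.[t] ^+ k by rewrite hE// divfK ?qe.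
  rewrite pE; have := hh t qt; move: (h t) (_ ^+ k) => c u cc.
  by transitivity (q.[t] * u * u * (c * c - c)); [ring|rewrite cc subrr mulr0].
rewrite !mulf_eq0 (negPf q0)/= => /orP[/eqP p0|].
  by rewrite !hE// p0 !horner0 !mul0r.
by rewrite subr_eq0 => /eqP pq; rewrite !hE// pq !horner_exp !divff ?qe.
Qed.

Definition rational_mx (q : {poly K}) r s (M : K -> 'M[K]_(r, s)) : Prop :=
  forall i j, rational_on q (fun t => M t i j).

Lemma rational_mx_const q r s (M : 'M[K]_(r, s)) : rational_mx q (fun=> M).
Proof. by move=> i j; exact: rationalC. Qed.

Lemma rational_mx_mul q r s u (M : K -> 'M[K]_(r, s)) (N : K -> 'M[K]_(s, u)) :
  rational_mx q M -> rational_mx q N -> rational_mx q (fun t => M t *m N t).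
Proof.
move=> Mr Nr i j; under eq_fun do rewrite mxE.
by apply: rational_sum => k; exact: rationalM.
Qed.

Lemma rational_mx_mull q q' r s (M : K -> 'M[K]_(r, s)) :
  rational_mx q M -> rational_mx (q' * q) M.
Proof. by move=> Mr i j; exact: rational_mull. Qed.

Lemma rational_mx_horner q r s (G : 'M[{poly K}]_(r, s)) :
  rational_mx q (fun t => map_mx (horner_eval t) G).
Proof. by move=> i j; under eq_fun do rewrite mxE; exact: rational_horner. Qed.

Lemma det_horner r (G : 'M[{poly K}]_r) t :
  \det (map_mx (horner_eval t) G) = (\det G).[t].
Proof. by rewrite det_map_mx. Qed.

Lemma rational_mx_inv r (G : 'M[{poly K}]_r) :
  rational_mx (\det G) (fun t => invmx (map_mx (horner_eval t) G)).
Proof.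
move=> i j; have [p [k pE]] := rationalM (rationalV (\det G))
  (rational_horner (\det G) ((\adj G) i j)).
exists p, k => t Gt; rewrite -pE//= /invmx unitmxE det_horner unitfE Gt -map_mx_adj.
by rewrite mxE; congr (_ * _); rewrite mxE.
Qed.

(** A line in matrix space from the identity, at 0, to P, at 1.  It leaves the
general linear group at finitely many points only. *)
Definition pencil r (P : 'M[K]_r) : 'M[{poly K}]_r :=
  1%:M + 'X *: map_mx polyC (P - 1%:M).

Lemma pencilE r (P : 'M[K]_r) t :
  map_mx (horner_eval t) (pencil P) = 1%:M + t *: (P - 1%:M).
Proof.
apply/matrixP => i j; rewrite !mxE /horner_eval !hornerE.
by case: eqP => _; rewrite ?hornerE.
Qed.

Lemma pencil0 r (P : 'M[K]_r) : map_mx (horner_eval 0) (pencil P) = 1%:M.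
Proof. by rewrite pencilE scale0r addr0. Qed.

Lemma pencil1 r (P : 'M[K]_r) : map_mx (horner_eval 1) (pencil P) = P.
Proof. by rewrite pencilE scale1r addrC subrK. Qed.

End RationalCurves.

(** * Pairs of matrices joined by rational curves *)

Section Links.
Variables (K : numClosedFieldType) (n m : nat).

Definition matpair_regular r : set ('M[K]_r * 'M[K]_r -> K) :=
  generated_algebra
    ([set f | exists i j, f = fun x : 'M[K]_r * 'M[K]_r => x.1 i j] `|`
     [set f | exists i j, f = fun x : 'M[K]_r * 'M[K]_r => x.2 i j]).

Lemma matpair_regular_pullback (T : Type) (S : set (T -> K)) r
    (phi : T -> 'M[K]_r * 'M[K]_r) f :
  subalgebra_of_functions S ->
  (forall i j, S (fun t => (phi t).1 i j)) ->
  (forall i j, S (fun t => (phi t).2 i j)) ->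
  matpair_regular f -> S (f \o phi).
Proof.
move=> [Sc SBM] S1 S2 /(_ [set f : 'M[K]_r * 'M[K]_r -> K | S (f \o phi)]).
apply; split.
  split=> [c|g h Sg Sh]; first exact: Sc.
  exact: SBM _ _ Sg Sh.
by move=> _ [|] [i [j ->]]; [exact: S1|exact: S2].
Qed.

(** Prescribing the determinants makes the inverse of the determinant a
constant, so that polynomial functions of the entries suffice, and it lets the
diagonal blocks of a pair be moved without changing the determinants of the
whole. *)
Definition slice r (d e : K) : set ('M[K]_r * 'M[K]_r) :=
  [set x | [/\ x.1 ^+ n = x.2 ^+ m, \det x.1 = d & \det x.2 = e]].

(** For points of the slice, lying in the same connected component.  Stated
through idempotent functions rather than through chains of curves, the relation
is transitive at once and passes from a block to the whole matrix by composing
functions. *)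
Definition linked r d e (x y : 'M[K]_r * 'M[K]_r) : Prop :=
  forall f, matpair_regular f ->
    (forall z, slice d e z -> f z * f z = f z) -> f x = f y.

Lemma linked_trans r d e (x y z : 'M[K]_r * 'M[K]_r) :
  linked d e x y -> linked d e y z -> linked d e x z.
Proof. by move=> xy yz f fr fi; rewrite xy// yz. Qed.

Lemma linked_curve r d e q (g : K -> 'M[K]_r * 'M[K]_r) a b :
  rational_mx q (fun t => (g t).1) -> rational_mx q (fun t => (g t).2) ->
  (forall t, q.[t] != 0 -> slice d e (g t)) ->
  q.[a] != 0 -> q.[b] != 0 -> linked d e (g a) (g b).
Proof.
move=> g1 g2 gs qa qb f fr fi.
apply: (@rational_idempotent_const K q (f \o g)) => //.
  by apply: (matpair_regular_pullback _ _ _ fr) => //; exact: rational_subalgebra.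
by move=> t /gs /fi.
Qed.

Lemma conj_exp r (P A : 'M[K]_r) k : P \in unitmx ->
  (P *m A *m invmx P) ^+ k = P *m A ^+ k *m invmx P.
Proof.
move=> Pu; elim: k => [|k IHk]; first by rewrite !expr0 mulmx1 mulmxV.
by rewrite !exprSr IHk -!mulmxE !mulmxA mulmxKV.
Qed.

Lemma det_conj r (P A : 'M[K]_r) : P \in unitmx ->
  \det (P *m A *m invmx P) = \det A.
Proof.
move=> Pu; rewrite -mulmxA det_mulmx mulrC det_mulmx -mulrA -det_mulmx.
by rewrite mulVmx// det1 mulr1.
Qed.

Lemma conj_scalar r (P : 'M[K]_r) c : P \in unitmx ->
  P *m c%:M *m invmx P = c%:M.
Proof. by move=> Pu; rewrite scalar_mxC mulmxK. Qed.

Lemma slice_conj r d e (P Q A B : 'M[K]_r) :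
  P = Q \/ is_scalar_mx (A ^+ n) ->
  P \in unitmx -> Q \in unitmx ->
  slice d e (A, B) -> slice d e (P *m A *m invmx P, Q *m B *m invmx Q).
Proof.
move=> PQ Pu Qu [/= AB dA dB]; split; rewrite /= ?det_conj// !conj_exp//.
case: PQ => [->|/is_scalar_mxP[c cE]]; first by rewrite AB.
by rewrite -AB cE !conj_scalar.
Qed.

(** The conjugating matrices P and Q may be chosen independently when A ^+ n is
scalar, because conjugation fixes scalar matrices. *)
Lemma linked_conj r d e (P Q A B : 'M[K]_r) :
  P = Q \/ is_scalar_mx (A ^+ n) ->
  P \in unitmx -> Q \in unitmx -> slice d e (A, B) ->
  linked d e (A, B) (P *m A *m invmx P, Q *m B *m invmx Q).
Proof.
move=> PQ Pu Qu sAB; pose G := pencil P; pose H := pencil Q.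
pose ev t := map_mx (horner_eval t) : 'M[{poly K}]_r -> 'M[K]_r.
pose q := \det G * \det H.
pose g t := (ev t G *m A *m invmx (ev t G), ev t H *m B *m invmx (ev t H)).
have -> : (A, B) = g 0 by rewrite /g /ev !pencil0 !invmx1 !mul1mx !mulmx1.
have -> : (P *m A *m invmx P, Q *m B *m invmx Q) = g 1 by rewrite /g /ev !pencil1.
apply: (@linked_curve _ _ _ q g).
- do 2?[apply: rational_mx_mul];
    [exact: rational_mx_horner|exact: rational_mx_const|].
  by rewrite /q mulrC; apply: rational_mx_mull; exact: rational_mx_inv.
- do 2?[apply: rational_mx_mul];
    [exact: rational_mx_horner|exact: rational_mx_const|].
  by apply: rational_mx_mull; exact: rational_mx_inv.
- move=> t; rewrite hornerM mulf_eq0 => /norP[Gt Ht].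
  apply: slice_conj => //; last 2 first.
  + by rewrite unitmxE det_horner unitfE.
  + by rewrite unitmxE det_horner unitfE.
  by case: PQ => [PQ|]; [left; rewrite /G PQ|right].
- by rewrite hornerM -!det_horner !pencil0 !det1 mulr1 oner_neq0.
- by rewrite hornerM -!det_horner !pencil1 mulf_neq0// -unitfE -unitmxE.
Qed.

End Links.

(** * Degeneration to diagonal pairs *)

Section Degeneration.
Variables (K : numClosedFieldType) (n m : nat).
Hypotheses (n_gt0 : (0 < n)%N) (m_gt0 : (0 < m)%N).
Local Notation slice := (slice n m).
Local Notation linked := (linked n m).

Lemma block_lower_exp k l (A : 'M[K]_k) (D : 'M[K]_l) (C : 'M[K]_(l, k)) i :
  exists E : 'M[K]_(l, k), forall t : K,
    block_mx A 0 (t *: C) D ^+ i = block_mx (A ^+ i) 0 (t *: E) (D ^+ i).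
Proof.
elim: i => [|i [E IH]].
  by exists 0 => t; rewrite !expr0 scaler0 -scalar_mx_block.
exists (C *m A ^+ i + D *m E) => t.
rewrite !exprS IH -!mulmxE mulmx_block.
by rewrite !mul0mx !mulmx0 !addr0 add0r -scalemxAl -scalemxAr scalerDr.
Qed.

(** Multiplying the off-diagonal blocks by t multiplies those of the powers by
t as well, so the curve stays in the slice down to t = 0. *)
Lemma linked_block_diag k l d e (A A' : 'M[K]_k) (D D' : 'M[K]_l)
    (C C' : 'M[K]_(l, k)) :
  slice d e (block_mx A 0 C D, block_mx A' 0 C' D') ->
  [/\ slice (\det A) (\det A') (A, A'), slice (\det D) (\det D') (D, D'),
      d = \det A * \det D, e = \det A' * \det D' &
      linked d e (block_mx A 0 C D, block_mx A' 0 C' D')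
                 (block_mx A 0 0 D, block_mx A' 0 0 D')].
Proof.
move=> [/= + <- <-]; rewrite !det_lblock => AD.
have [E EE] := block_lower_exp A D C n.
have [E' EE'] := block_lower_exp A' D' C' m.
have := AD; rewrite -[C]scale1r -[C']scale1r EE EE' => /eq_block_mx[AA _ EE1 DD].
split=> //.
pose g (t : K) := (block_mx A 0 (t *: C) D, block_mx A' 0 (t *: C') D').
rewrite -/(g 1).
have -> : (block_mx A 0 0 D, block_mx A' 0 0 D') = g 0 by rewrite /g !scale0r.
have gr k' l' (X : 'M[K]_k') (Z : 'M[K]_l') (Y : 'M[K]_(l', k')) :
    rational_mx 1 (fun t : K => block_mx X 0 (t *: Y) Z).
  pose G := block_mx (map_mx polyC X) 0 ('X *: map_mx polyC Y) (map_mx polyC Z).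
  suff -> : (fun t => block_mx X 0 (t *: Y) Z)
      = (fun t => map_mx (horner_eval t) G).
    exact: rational_mx_horner.
  apply/funext => t.
  rewrite map_block_mx map_mx0 map_mxZ/= /horner_eval hornerX -!map_mx_comp.
  by congr (block_mx _ 0 (_ *: _) _); apply/matrixP => i' j';
    rewrite mxE/= /horner_eval hornerC.
apply: (@linked_curve _ _ _ _ _ _ 1); rewrite ?hornerC ?oner_neq0//.
- exact: gr.
- exact: gr.
- move=> t _; split; rewrite /= ?det_lblock// EE EE' AA DD.
  by rewrite -[E]scale1r EE1 scale1r.
Qed.

Lemma slice_block k l d e d' e' (x : 'M[K]_k * 'M[K]_k)
    (y : 'M[K]_l * 'M[K]_l) :
  slice d e x -> slice d' e' y ->
  slice (d * d') (e * e') (block_mx x.1 0 0 y.1, block_mx x.2 0 0 y.2).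
Proof.
move=> [x12 dx ex] [y12 dy ey]; split; rewrite /= ?det_ublock ?dx ?ex ?dy ?ey//.
have blockX (A : 'M[K]_k) (D : 'M[K]_l) i :
    block_mx A 0 0 D ^+ i = block_mx (A ^+ i) 0 0 (D ^+ i).
  by have [E /(_ 0)] := block_lower_exp A D 0 i; rewrite !scale0r.
by rewrite !blockX x12 y12.
Qed.

Lemma block_diag_regular (T : Type) (S : set (T -> K)) k l
    (M : T -> 'M[K]_k) (N : T -> 'M[K]_l) :
  subalgebra_of_functions S ->
  (forall i j, S (fun t => M t i j)) -> (forall i j, S (fun t => N t i j)) ->
  forall i j, S (fun t => block_mx (M t) 0 0 (N t) i j).
Proof.
move=> [Sc _] SM SN i j.
case: (split_ordP i) (split_ordP j) => i' -> [] j' ->;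
  under eq_fun do rewrite ?block_mxEul ?block_mxEur ?block_mxEdl ?block_mxEdr;
  [exact: SM|under eq_fun do rewrite mxE..|exact: SN]; exact: Sc.
Qed.

Lemma linked_blockl k l d e d' e' (x x' : 'M[K]_k * 'M[K]_k)
    (y : 'M[K]_l * 'M[K]_l) :
  slice d' e' y -> linked d e x x' ->
  linked (d * d') (e * e') (block_mx x.1 0 0 y.1, block_mx x.2 0 0 y.2)
                           (block_mx x'.1 0 0 y.1, block_mx x'.2 0 0 y.2).
Proof.
move=> sy xx' f fr fi.
pose phi (z : 'M[K]_k * 'M[K]_k) := (block_mx z.1 0 0 y.1, block_mx z.2 0 0 y.2).
apply: (xx' (f \o phi)); last by move=> z sz; apply: fi; exact: slice_block.
have regA : subalgebra_of_functions (@matpair_regular K k).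
  exact: generated_algebraP.
apply: (matpair_regular_pullback _ _ _ fr) => // i j;
  apply: block_diag_regular => // i' j'; try exact: regA.1.
  by apply: sub_gen_smallest; left; exists i', j'.
by apply: sub_gen_smallest; right; exists i', j'.
Qed.

Lemma linked_blockr k l d e d' e' (x : 'M[K]_k * 'M[K]_k)
    (y y' : 'M[K]_l * 'M[K]_l) :
  slice d e x -> linked d' e' y y' ->
  linked (d * d') (e * e') (block_mx x.1 0 0 y.1, block_mx x.2 0 0 y.2)
                           (block_mx x.1 0 0 y'.1, block_mx x.2 0 0 y'.2).
Proof.
move=> sx yy' f fr fi.
pose phi (z : 'M[K]_l * 'M[K]_l) := (block_mx x.1 0 0 z.1, block_mx x.2 0 0 z.2).
apply: (yy' (f \o phi)); last by move=> z sz; apply: fi; exact: slice_block.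
have regA : subalgebra_of_functions (@matpair_regular K l).
  exact: generated_algebraP.
apply: (matpair_regular_pullback _ _ _ fr) => // i j;
  apply: block_diag_regular => // i' j'; try exact: regA.1.
  by apply: sub_gen_smallest; left; exists i', j'.
by apply: sub_gen_smallest; right; exists i', j'.
Qed.

(** The minimal polynomial divides 'X^i - c, which is separable in
characteristic 0 because c != 0. *)
Lemma root_scalar_diagonalizable r (A : 'M[K]_r) c i :
  (0 < i)%N -> c != 0 -> A ^+ i = c%:M ->
  exists2 P : 'M[K]_r, P \in unitmx & exists a, P *m A *m invmx P = diag_mx a.
Proof.
case: r A => [|r] A i0 c0 Ai.
  by exists 1%:M; [exact: unitmx1|exists 0; apply/matrixP => -[]].
suff /diagonalizableP[P Pu /diagonalizable_forPex[a /(simmxRL Pu) PA]] :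
    exists2 rs : seq K, uniq rs & mxminpoly A %| \prod_(x <- rs) ('X - x%:P).
  by exists P => //; exists a.
pose p : {poly K} := 'X^i - c%:P.
have [rs prs] := closed_field_poly_normal p.
rewrite (monicP (monicXnsubC _ i0)) scale1r in prs.
exists rs.
  rewrite -separable_prod_XsubC -prs unlock /=.
  apply: Pdiv.ClosedField.root_coprimep => x.
  rewrite /root !hornerE subr_eq0 => /eqP xc.
  rewrite derivD derivN derivC subr0 derivXn hornerMn hornerXn mulrn_eq0 negb_or.
  rewrite -lt0n i0/= expf_neq0//; apply: contraNneq c0 => x0.
  by rewrite -xc x0 expr0n gtn_eqF.
by rewrite -prs mxminpoly_min// rmorphB/= rmorphXn/= horner_mx_X horner_mx_C Ai subrr.
Qed.

(** The first k rows of the extended row base of V span V. *)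
Lemma stable_block k l (V : 'M[K]_(k + l)) : \rank V = k ->
  exists2 P : 'M[K]_(k + l), P \in unitmx &
    forall A, stablemx V A -> ursubmx (P *m A *m invmx P) = 0.
Proof.
move=> rV; exists (row_ebase V); first exact: row_ebase_unit.
move=> A; set P := row_ebase V.
have Pu : P \in unitmx by exact: row_ebase_unit.
have VE : (V :=: usubmx P)%MS.
  rewrite -{1}(mulmx_ebase V) rV -/P -mulmxA.
  apply: eqmx_trans (eqmxMfull _ _) _.
    by rewrite row_full_unit col_ebase_unit.
  rewrite -{1}[P]vsubmxK pid_mx_block mul_block_col !mul0mx mul1mx !addr0.
  by apply/eqmxP; rewrite col_mx_sub sub0mx submx_refl/= -addsmxE addsmxSl.
rewrite (eqmxMr _ VE) VE => /submxP[X XE].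
rewrite /ursubmx -!mul_usub_mx XE -mulmxA mul_usub_mx mulmxV// -mulmx_rsub.
by rewrite scalar_mx_block -/(ursubmx _) block_mxKur mulmx0.
Qed.

Lemma det_exp r (A : 'M[K]_r) i : \det (A ^+ i) = \det A ^+ i.
Proof. by elim: i => [|i IHi]; rewrite ?det1// !exprS -mulmxE det_mulmx IHi. Qed.

(** Strong induction on the size, on an eigenspace V of C = A ^+ n.  Both A and
B commute with C, so V is stable.  If V is everything, C is scalar and A and B
are diagonalized independently; otherwise V splits the pair into two smaller
ones. *)
Lemma linked_diag r d e (A B : 'M[K]_r) : d != 0 -> slice d e (A, B) ->
  exists a b, slice d e (diag_mx a, diag_mx b) /\
    linked d e (A, B) (diag_mx a, diag_mx b).
Proof.
elim/ltn_ind: r d e A B => r IH d e A B d0 sAB.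
have [r0|r_gt0] := posnP r.
  subst r; exists 0, 0.
  suff <- : (A, B) = (diag_mx 0, diag_mx 0) by [].
  by congr pair; apply/matrixP => -[].
have [/= AB dA _] := sAB; pose C := A ^+ n.
have [c Cc] : exists c, eigenvalue C c.
  have /closed_rootP[c rc] : size (char_poly C) != 1.
    by rewrite size_char_poly; case: (r) r_gt0.
  by exists c; rewrite eigenvalue_root_char.
pose V := eigenspace C c.
have stab D : comm_mx C D -> stablemx V D by exact: comm_mx_stable_eigenspace.
have sA : stablemx V A by apply: stab; rewrite /comm_mx /C mulmxE -exprS exprSr.
have sB : stablemx V B by apply: stab; rewrite /comm_mx /C AB mulmxE -exprS exprSr.
have [Vfull|Vfull] := boolP (row_full V).
  have CE : C = c%:M.
    have /eigenspaceP := submx_full (1%:M : 'M[K]_r) Vfull.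
    by rewrite mul1mx scalemx1.
  have c0 : c != 0.
    have : \det C != 0 by rewrite /C det_exp dA expf_neq0.
    by apply: contraNneq => c0; rewrite CE det_scalar c0 expr0n gtn_eqF.
  have [P Pu [a PA]] := root_scalar_diagonalizable n_gt0 c0 CE.
  have [Q Qu [b QB]] := root_scalar_diagonalizable m_gt0 c0 (etrans (esym AB) CE).
  have sc : P = Q \/ is_scalar_mx (A ^+ n).
    by right; rewrite -/C CE scalar_mx_is_scalar.
  exists a, b; rewrite -PA -QB; split; first exact: slice_conj.
  exact: linked_conj.
have [k [l [rE kE]]] : exists k l, r = (k + l)%N /\ \rank V = k.
  exists (\rank V), (r - \rank V)%N.
  by split=> //; rewrite subnKC// rank_leq_row.
move: Vfull; rewrite /row_full kE => kr.
have k0 : (0 < k)%N by rewrite -kE lt0n mxrank_eq0.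
clearbody V; subst r; clear C Cc stab.
have l0 : (0 < l)%N by rewrite lt0n; apply: contraNneq kr => ->; rewrite addn0.
have [P Pu ur0] := stable_block kE.
set A' := P *m A *m invmx P; set B' := P *m B *m invmx P.
have AE : A' = block_mx (ulsubmx A') 0 (dlsubmx A') (drsubmx A').
  by rewrite -{1}[A']submxK ur0.
have BE : B' = block_mx (ulsubmx B') 0 (dlsubmx B') (drsubmx B').
  by rewrite -{1}[B']submxK ur0.
have PP : P = P \/ is_scalar_mx (A ^+ n) by left.
have lAB := linked_conj PP Pu Pu sAB.
have := slice_conj PP Pu Pu sAB.
move: lAB; rewrite -/A' -/B' AE BE => lAB /linked_block_diag[s1 s2 dE eE lAB'].
move: d0; rewrite dE mulf_eq0 => /norP[d1 d2].
have [|a1 [b1 [sl1 li1]]] := IH k _ _ _ _ _ d1 s1.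
  by rewrite -[ltnLHS]addn0 ltn_add2l.
have [|a2 [b2 [sl2 li2]]] := IH l _ _ _ _ _ d2 s2.
  by rewrite -[ltnLHS]add0n ltn_add2r.
exists (row_mx a1 a2), (row_mx b1 b2); rewrite !diag_mx_row; split.
  by rewrite eE; exact: (slice_block sl1 sl2).
rewrite dE eE in lAB lAB' *.
apply: linked_trans lAB _; apply: linked_trans lAB' _.
apply: linked_trans (linked_blockl s2 li1) _.
exact: (linked_blockr sl1 li2).
Qed.

End Degeneration.

(** * Diagonal pairs *)

Section Torus.
Variables (K : numClosedFieldType) (n m : nat).
Hypotheses (n_gt0 : (0 < n)%N) (m_gt0 : (0 < m)%N) (mn : coprime m n).

(** With u * m = v * n + 1, the root is s = a ^+ u / b ^+ v. *)
Lemma common_root (a b : K) : a != 0 -> a ^+ n = b ^+ m ->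
  exists s, [/\ s != 0, s ^+ m = a & s ^+ n = b].
Proof.
move=> a0 ab.
have b0 : b != 0.
  apply: contraNneq a0 => b0; move/eqP: ab.
  by rewrite b0 expr0n gtn_eqF// expf_eq0 => /andP[].
case: (egcdnP n m_gt0) => u v uv _; rewrite (eqP mn) in uv.
exists (a ^+ u / b ^+ v); split; first by rewrite mulf_neq0 ?invr_eq0 ?expf_neq0.
- rewrite exprMn exprVn -!exprM uv exprD expr1.
  rewrite [(v * m)%N]mulnC [X in _ / X]exprM.
  by rewrite -ab -exprM [(n * v)%N]mulnC mulrAC divff ?mul1r// expf_neq0.
- rewrite exprMn exprVn -!exprM [(u * n)%N]mulnC exprM ab.
  rewrite -exprM [(m * u)%N]mulnC uv exprD expr1.
  by rewrite mulrAC divff ?mul1r// expf_neq0.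
Qed.

Lemma coprime_exp_eq1 (s : K) : s ^+ m = 1 -> s ^+ n = 1 -> s = 1.
Proof.
move=> sm sn; case: (egcdnP n m_gt0) => u v uv _; rewrite (eqP mn) in uv.
have : s ^+ (u * m) = 1 by rewrite mulnC exprM sm expr1n.
by rewrite uv exprD expr1 mulnC exprM sn expr1n mul1r.
Qed.

Lemma rational_exp (q : {poly K}) f k :
  rational_on q f -> rational_on q (fun t => f t ^+ k).
Proof.
move=> fr; elim: k => [|k IHk]; first exact: rationalC.
by under eq_fun do rewrite exprS; exact: rationalM.
Qed.

Lemma diag_exp r (a : 'rV[K]_r) k : diag_mx a ^+ k = diag_mx (\row_i a 0 i ^+ k).
Proof.
elim: k => [|k IHk].
  by rewrite expr0; apply/matrixP => i j; rewrite !mxE expr0.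
rewrite exprS IHk -mulmxE mulmx_diag; congr diag_mx.
by apply/rowP => i; rewrite !mxE exprS.
Qed.

(** The pair is (diag (s ^+ m), diag (s ^+ n)) with the product of the s_i equal
to 1, and s moves to 1 along a line, corrected in one coordinate so as to keep
this product. *)
Lemma linked_diag1 r (a b : 'rV[K]_r.+1) :
  slice n m 1 1 (diag_mx a, diag_mx b) ->
  linked n m 1 1 (diag_mx a, diag_mx b) (1%:M, 1%:M).
Proof.
case; rewrite /= !diag_exp !det_diag => ab da db.
have a0 i : a 0 i != 0.
  by have := oner_neq0 K; rewrite -da => /prodf_neq0/(_ i isT).
have /choice[s sE] : forall i, exists s,
    [/\ s != 0, s ^+ m = a 0 i & s ^+ n = b 0 i].
  move=> i; apply: common_root => //.
  by move/matrixP/(_ i i) : ab; rewrite !mxE eqxx !mulr1n.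
pose u i : {poly K} := 1 + 'X * (s i - 1)%:P.
have u0 i : (u i).[0] = 1 by rewrite !hornerE.
have u1 i : (u i).[1] = s i.
  by rewrite hornerD hornerM !hornerC hornerX mul1r addrC subrK.
pose q := \prod_i u i.
have q0 : q.[0] = 1 by rewrite horner_prod big1.
have q1 : q.[1] = 1.
  rewrite horner_prod; under eq_bigr do rewrite u1.
  apply: coprime_exp_eq1; rewrite -prodrXl.
    by rewrite -[RHS]da; apply: eq_bigr => i _; have [] := sE i.
  by rewrite -[RHS]db; apply: eq_bigr => i _; have [] := sE i.
(* Dividing one coordinate by the product q keeps the product equal to 1; as q
   is 1 at both ends, the endpoints are unchanged. *)
pose w t i := (u i).[t] * (if i == ord0 then q.[t]^-1 else 1).
have w1 t : q.[t] != 0 -> \prod_i w t i = 1.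
  by move=> qt; rewrite big_split/= -horner_prod -big_mkcond/= big_pred1_eq divff.
pose g t : 'M[K]_r.+1 * 'M[K]_r.+1 :=
  (diag_mx (\row_i w t i ^+ m), diag_mx (\row_i w t i ^+ n)).
have -> : (diag_mx a, diag_mx b) = g 1.
  have wE i : w 1 i = s i by rewrite /w u1 q1 invr1 if_same mulr1.
  by congr (diag_mx _, diag_mx _); apply/rowP => i;
    rewrite mxE wE; have [] := sE i.
have -> : (1%:M, 1%:M) = g 0.
  have wE i : w 0 i = 1 by rewrite /w u0 q0 invr1 if_same mulr1.
  rewrite /g -!diag_const_mx.
  by congr (diag_mx _, diag_mx _); apply/rowP => i; rewrite !mxE wE expr1n.
have gr k : rational_mx q (fun t => diag_mx (\row_i w t i ^+ k)).
  move=> i j; under eq_fun do rewrite !mxE -mulr_natr.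
  apply: rationalM; last exact: rationalC.
  apply: rational_exp; apply: (@rationalM _ _ (horner (u i))
    (fun t => if i == ord0 then q.[t]^-1 else 1)); first exact: rational_horner.
  by case: (i == ord0); [exact: rationalV|exact: rationalC].
apply: (@linked_curve _ _ _ _ _ _ q); rewrite ?q0 ?q1 ?oner_neq0//.
- exact: gr.
- exact: gr.
- move=> t qt; split; rewrite /=.
  + rewrite !diag_exp; congr diag_mx; apply/rowP => i.
    by rewrite !mxE -!exprM mulnC.
  + rewrite det_diag; under eq_bigr do rewrite mxE.
    by rewrite prodrXl w1 ?expr1n.
  + rewrite det_diag; under eq_bigr do rewrite mxE.
    by rewrite prodrXl w1 ?expr1n.
Qed.

Lemma linked1 r (x : 'M[K]_r * 'M[K]_r) : (0 < r)%N -> slice n m 1 1 x ->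
  linked n m 1 1 x (1%:M, 1%:M).
Proof.
case: r x => // r [A B] _ sx.
have [a [b [sab lab]]] := linked_diag n_gt0 m_gt0 (oner_neq0 K) sx.
exact: linked_trans lab (linked_diag1 sab).
Qed.

End Torus.

(** * Regular functions on the representation variety *)

(** Evaluation at a representation has a prime kernel, so an invariant that is
idempotent modulo every prime has only the values 0 and 1. *)
Lemma charvar_connected (K : fieldType) (G : groupType) (O : set (G -> K)) n m :
  (forall f : repvar G n m -> K, repvar_regular O f ->
     (forall p, f p * f p = f p) -> forall p q, f p = f q) ->
  connected [set: charvar O n m].
Proof.
move=> fconst; apply: Spec_connected => a aa.
have aid p : a p * a p = a p.
  have evP : idealr_closed (fun f : invariant_ring O n m => f p == 0).
    split=> [||b f g /eqP fp /eqP gp]; rewrite !unfold_in//.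
    - exact: oner_neq0.
    - have -> : (b * f + g) p = b p * f p + g p by [].
      by rewrite fp gp mulr0 addr0.
  have evprime : prime_idealr_closed (fun f : invariant_ring O n m => f p == 0).
    by move=> f g; rewrite !unfold_in mulf_eq0.
  have := aa (MkSpec evP evprime); rewrite unfold_in/= mulf_eq0.
  by rewrite subr_eq0 => /orP[/eqP ->|/eqP <-]; rewrite ?mul0r ?mul1r.
have /asboolP[areg _] := invariant_funP a.
have aconst := fconst a areg aid.
have := aid point; rewrite -[X in _ = X]mulr1 => /eqP.
rewrite -subr_eq0 -mulrBr mulf_eq0 subr_eq0 => /orP[]/eqP ap; [left|right];
  by apply: val_inj; apply/funext => p; rewrite [LHS](aconst p point).
Qed.

(** Membership of a pulled back function in an algebra S need only be tested
on generators of the coordinate ring of the group. *)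
Lemma repvar_regular_pullback (K : fieldType) (G : groupType) (E : set (G -> K))
    n m (T : Type) (S : set (T -> K)) (phi : T -> repvar G n m) f :
  subalgebra_of_functions S ->
  (forall g, E g -> S (fun t => g (val (phi t)).1)) ->
  (forall g, E g -> S (fun t => g (val (phi t)).2)) ->
  repvar_regular (generated_algebra E) f -> S (f \o phi).
Proof.
move=> [Sc SBM] S1 S2 /(_ [set f : repvar G n m -> K | S (f \o phi)]).
apply; split.
  split=> [c|g h Sg Sh]; first exact: Sc.
  exact: SBM _ _ Sg Sh.
move=> _ [|] [g Eg <-]; [apply: (Eg [set g | S (fun t => g (val (phi t)).1)])|
  apply: (Eg [set g | S (fun t => g (val (phi t)).2)])]; split=> //;
  by (split=> [c|h k Sh Sk]; [exact: Sc|exact: SBM _ _ Sh Sk]).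
Qed.

Definition Repvar (G : groupType) n m (p : G * G) (rep : is_rep n m p) :
  repvar G n m := exist _ p rep.

(** The junk value, on pairs that are not representations, is the trivial
representation. *)
Definition to_repvar (G : groupType) n m (p : G * G) : repvar G n m :=
  odflt (point : repvar G n m) (insub p : option {p : G * G | is_rep n m p}).

Lemma to_repvarK (G : groupType) n m (p : G * G) :
  is_rep n m p -> val (to_repvar n m p) = p.
Proof. by move=> rep; rewrite /to_repvar insubT. Qed.

(** * The three groups *)

Lemma GL_exp (K : fieldType) r (A : GL K r) k : GLmx (A ^+ k)%g = GLmx A ^+ k.
Proof. by elim: k => [|k IHk]; rewrite ?expg0 ?expr0// expgS exprS -IHk. Qed.

Lemma SL_exp (K : fieldType) r (A : SL K r) k : SLmx (A ^+ k)%g = (SLmx A ^+ k)%g.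
Proof. by elim: k => [|k IHk]; rewrite ?expg0// !expgS -IHk. Qed.

Lemma scalemx_exp (K : fieldType) r (c : K) (A : 'M[K]_r) k :
  (c *: A) ^+ k = c ^+ k *: A ^+ k.
Proof.
elim: k => [|k IHk]; first by rewrite !expr0 scale1r.
by rewrite !exprS IHk -!mulmxE -scalemxAl -scalemxAr scalerA.
Qed.

Section Groups.
Variables (K : numClosedFieldType) (n m r : nat).
Hypotheses (n_gt0 : (0 < n)%N) (m_gt0 : (0 < m)%N) (mn : coprime m n).
Hypothesis r_gt0 : (0 < r)%N.

(** A regular function on SL representations is a polynomial in the entries of
the two matrices, and these representations form the slice of determinants
(1, 1). *)
Lemma SL_idempotent_const (f : repvar (SL K r) n m -> K) :
  repvar_regular (@SL_regular K r) f -> (forall p, f p * f p = f p) ->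
  forall p q, f p = f q.
Proof.
move=> fr fi.
pose mx (p : repvar (SL K r) n m) : 'M[K]_r * 'M[K]_r :=
  (GLmx (SLmx (val p).1), GLmx (SLmx (val p).2)).
have [F [Freg FE]] : exists F, matpair_regular F /\ forall p, f p = F (mx p).
  have reg : subalgebra_of_functions (@matpair_regular K r) := generated_algebraP _.
  apply: (@repvar_regular_pullback _ _ _ _ _ _ [set f | exists F, matpair_regular F
    /\ forall p, f p = F (mx p)] id _ _ _ _ fr).
  - split=> [c|g h [F [Fr gE]] [H [Hr hE]]].
      by exists (cst c); split=> //; exact: reg.1.
    have [FB FM] := reg.2 _ _ Fr Hr.
    by split; [exists (F \- H)|exists (F \* H)]; split=> // p; rewrite /= gE hE.
  - move=> _ [i [j ->]]; exists (fun x : 'M[K]_r * 'M[K]_r => x.1 i j); split=> //.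
    by apply: sub_gen_smallest; left; exists i, j.
  - move=> _ [i [j ->]]; exists (fun x : 'M[K]_r * 'M[K]_r => x.2 i j); split=> //.
    by apply: sub_gen_smallest; right; exists i, j.
have Fid z : slice n m 1 1 z -> F z * F z = F z.
  case: z => A B [/= AB dA dB].
  have uA : A \in unitmx by rewrite unitmxE dA unitr1.
  have uB : B \in unitmx by rewrite unitmxE dB unitr1.
  have sA : MkGL uA \in @unimodular K r by rewrite inE/= dA.
  have sB : MkGL uB \in @unimodular K r by rewrite inE/= dB.
  have rep : is_rep n m (MkSL sA, MkSL sB).
    rewrite /is_rep/=; apply/eqP; apply: val_inj; apply: val_inj.
    by rewrite /= !SL_exp !GL_exp.
  have := fi (Repvar rep); rewrite FE.
  exact.
have f1 p : f p = F (1%:M, 1%:M).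
  rewrite FE; apply: (linked1 n_gt0 m_gt0 mn r_gt0 _ Freg Fid).
  case: p => -[A B] rep; have /eqP/= AB := rep; split; rewrite /=.
  - by rewrite -!GL_exp -!SL_exp AB.
  - by apply/eqP; exact: (SLmx_det A).
  - by apply/eqP; exact: (SLmx_det B).
by move=> p q; rewrite !f1.
Qed.

(** The junk value at c = 0 is the identity. *)
Definition GL_scale (c : K) (A : GL K r) : GL K r :=
  insubd (1%g : GL K r) (c *: GLmx A).

Lemma GL_scaleE c A : c != 0 -> GLmx (GL_scale c A) = c *: GLmx A.
Proof. by move=> c0; rewrite [LHS]val_insubd unitmxZ ?unitfE// GLmx_unit. Qed.

(** The determinants of A and B satisfy the equation of the curve, hence are
u ^+ m and u ^+ n.  With c ^+ r = u, dividing A by c ^+ m and B by c ^+ n gives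
an SL representation, and t in place of c gives a curve that joins it, at
t = 1, to (A, B), at t = c. *)
Lemma GL_idempotent_const (f : repvar (GL K r) n m -> K) :
  repvar_regular (@GL_regular K r) f -> (forall p, f p * f p = f p) ->
  forall p q, f p = f q.
Proof.
move=> fr fi.
pose incl (p : repvar (SL K r) n m) : repvar (GL K r) n m :=
  to_repvar n m
  (SLmx (val p).1, SLmx (val p).2).
have inclE p : val (incl p) = (SLmx (val p).1, SLmx (val p).2).
  by rewrite to_repvarK// /is_rep/= -!SL_exp (eqP (valP p)).
have inclconst : forall p q, f (incl p) = f (incl q).
  have reg : subalgebra_of_functions
    (repvar_regular (@SL_regular K r) (n := n) (m := m)) := generated_algebraP _.
  have detSL (A : SL K r) : \det (GLmx (SLmx A)) = 1 := eqP (SLmx_det A).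
  apply: (@SL_idempotent_const (f \o incl)); last by move=> p; exact: fi.
  apply: (repvar_regular_pullback reg _ _ fr).
  - move=> _ [[i [j ->]]|->].
      under eq_fun do rewrite inclE/=.
      apply: sub_gen_smallest; left.
      exists (fun A : SL K r => (A : 'M[K]_r) i j) => //.
      by apply: sub_gen_smallest; exists i, j.
    rewrite (_ : (fun _ => _) = cst 1); first exact: reg.1.
    by apply/funext => p; rewrite inclE/= detSL invr1.
  - move=> _ [[i [j ->]]|->].
      under eq_fun do rewrite inclE/=.
      apply: sub_gen_smallest; right.
      exists (fun A : SL K r => (A : 'M[K]_r) i j) => //.
      by apply: sub_gen_smallest; exists i, j.
    rewrite (_ : (fun _ => _) = cst 1); first exact: reg.1.
    by apply/funext => p; rewrite inclE/= detSL invr1.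
suff fincl p : exists q, f p = f (incl q).
  by move=> p q; have [p' ->] := fincl p; have [q' ->] := fincl q.
case: p => -[A B] AB.
have det0 (C : GL K r) : \det (GLmx C) != 0 by rewrite -unitfE -unitmxE GLmx_unit.
have [u [u0 um un]] : exists u,
    [/\ u != 0, u ^+ m = \det (GLmx A) & u ^+ n = \det (GLmx B)].
  apply: (common_root m_gt0 mn (det0 A)).
  by rewrite -!det_exp -!GL_exp (eqP AB).
pose c := r.-root u.
have cr : c ^+ r = u by rewrite rootCK.
have c0 : c != 0 by apply: contraNneq u0 => c0; rewrite -cr c0 expr0n gtn_eqF.
have ck k : c ^+ k != 0 by rewrite expf_neq0.
pose g t : repvar (GL K r) n m := to_repvar n m
 
  (GL_scale ((t / c) ^+ m) A, GL_scale ((t / c) ^+ n) B).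
have gE t : t != 0 ->
    val (g t) = (GL_scale ((t / c) ^+ m) A, GL_scale ((t / c) ^+ n) B).
  move=> t0; rewrite to_repvarK//.
  have tc k : (t / c) ^+ k != 0 by rewrite expf_neq0// mulf_neq0// invr_eq0.
  rewrite /is_rep/=; apply/eqP/val_inj; rewrite /= !GL_exp !GL_scaleE// !scalemx_exp.
  by rewrite -!exprM mulnC -!GL_exp (eqP AB).
have sl k C : \det (GLmx C) = u ^+ k -> GL_scale (c^-1 ^+ k) C \in @unimodular K r.
  move=> dC; rewrite inE/= GL_scaleE ?expf_neq0 ?invr_eq0// detZ dC -cr -!exprM.
  by rewrite exprVn mulnC mulVf// expf_neq0.
have slA := sl m A (esym um); have slB := sl n B (esym un).
have rep1 : is_rep n m (MkSL slA, MkSL slB).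
  have := valP (g 1); rewrite gE ?oner_neq0// /is_rep/= !div1r => /eqP rep.
  by apply/eqP/val_inj; rewrite /= !SL_exp.
exists (Repvar rep1).
rewrite -/(Repvar AB); have -> : Repvar AB = g c.
  apply: val_inj; rewrite gE//= divff// !expr1n.
  by congr pair; apply: val_inj; rewrite /= GL_scaleE ?oner_neq0// scale1r.
have -> : incl (Repvar rep1) = g 1.
  by apply: val_inj; rewrite gE ?oner_neq0// inclE/= !div1r.
have scaleX k (C : GL K r) i j :
    rational_on 'X (fun t => GL_scale ((t / c) ^+ k) C i j).
  exists (((c^-1)^+k * C i j) *: 'X^k), 0%N => t; rewrite hornerX => t0.
  rewrite GL_scaleE ?expf_neq0 ?mulf_neq0 ?invr_eq0// mxE hornerZ hornerXn.
  by rewrite expr0 divr1 exprMn [RHS]mulrC mulrA.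
have scaleD k (C : GL K r) :
    rational_on 'X (fun t => (\det (GLmx (GL_scale ((t / c) ^+ k) C)))^-1).
  exists (c ^+ k ^+ r / \det (GLmx C))%:P, (k * r)%N => t; rewrite hornerX => t0.
  rewrite GL_scaleE ?expf_neq0 ?mulf_neq0 ?invr_eq0// detZ hornerC.
  by rewrite invfM -!exprM exprMn invfM exprVn invrK -mulrA [LHS]mulrC.
have loc h h' : (forall t, t != 0 -> h t = h' t) ->
    rational_on 'X h' -> rational_on 'X h.
  move=> hh' [p [k h'E]]; exists p, k => t t0; rewrite hh' ?h'E//.
  by rewrite hornerX in t0.
apply: (@rational_idempotent_const K 'X (f \o g)).
- apply: (repvar_regular_pullback (rational_subalgebra _) _ _ fr).
  + move=> _ [[i [j ->]]|->].
      by apply: loc (scaleX m A i j) => t /gE ->.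
    by apply: loc (scaleD m A) => t /gE ->.
  + move=> _ [[i [j ->]]|->].
      by apply: loc (scaleX n B i j) => t /gE ->.
    by apply: loc (scaleD n B) => t /gE ->.
- by move=> t _; exact: fi.
- by rewrite hornerX.
- by rewrite hornerX oner_neq0.
Qed.

Lemma PGL_exp (A : GL K r) k :
  (\pi_(PGL K r)%qT A ^+ k)%g = \pi_(PGL K r)%qT (A ^+ k)%g.
Proof.
elim: k => [|k IHk]; first by rewrite !expg0.
by rewrite !expgS IHk; exact: PGL_piM.
Qed.

(** Regular functions pull back along the map from GL representations, which is
surjective: if A ^+ n = c *: B ^+ m and s ^+ n = c^-1, then (s *: A, B) is a
representation with the same image as (A, B). *)
Lemma PGL_idempotent_const (f : repvar (PGL K r) n m -> K) :
  repvar_regular (@PGL_regular K r) f -> (forall p, f p * f p = f p) ->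
  forall p q, f p = f q.
Proof.
move=> fr fi.
pose proj (p : repvar (GL K r) n m) : repvar (PGL K r) n m :=
  to_repvar n m
  (\pi_(PGL K r)%qT (val p).1, \pi_(PGL K r)%qT (val p).2).
have projE p : val (proj p) =
    (\pi_(PGL K r)%qT (val p).1, \pi_(PGL K r)%qT (val p).2).
  by rewrite to_repvarK// /is_rep/= !PGL_exp (eqP (valP p)).
have projconst : forall p q, f (proj p) = f (proj q).
  apply: (@GL_idempotent_const (f \o proj)); last by move=> p; exact: fi.
  have [Sc SBM] : subalgebra_of_functions
    (repvar_regular (@GL_regular K r) (n := n) (m := m)) := generated_algebraP _.
  apply: (fr [set f : repvar (PGL K r) n m -> K |
    repvar_regular (@GL_regular K r) (f \o proj)]); split.
    by split=> [c|g h Sg Sh]; [exact: Sc|exact: SBM _ _ Sg Sh].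
  move=> _ [|] [g greg <-]; rewrite /comp/=; under eq_fun do rewrite projE/=;
    apply: sub_gen_smallest; [left|right];
    by exists (fun A => g (\pi_(PGL K r)%qT A)).
suff fproj p : exists q, p = proj q.
  by move=> p q; have [p' ->] := fproj p; have [q' ->] := fproj q.
case: p => -[a b] ab; have := ab; rewrite /is_rep/= => /eqP.
rewrite -{1}[a]reprK -{1}[b]reprK !PGL_exp.
move/eqP; rewrite piE => /asboolP[c c0 AB].
pose s := n.-root c^-1.
have sn : s ^+ n = c^-1 by rewrite rootCK.
have s0 : s != 0.
  have := invr_eq0 c; rewrite (negPf c0) => /negbT.
  by apply: contraNneq => s0; rewrite -sn s0 expr0n gtn_eqF.
have rep : is_rep n m (GL_scale s (repr a), repr b).
  apply/eqP/val_inj; rewrite /= GL_exp GL_scaleE// scalemx_exp -GL_exp AB sn.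
  by rewrite scalerA mulVf// scale1r.
exists (Repvar rep); apply: val_inj; rewrite projE/= reprK.
congr pair; rewrite -[LHS]reprK; apply: PGL_pi_eq.
by exists s^-1; rewrite ?invr_eq0// GL_scaleE// scalerA mulVf// scale1r.
Qed.

End Groups.

Theorem corollary5p4 (R : realType) (m n r : nat)
    (m_gt0 : (0 < m)%N) (n_gt0 : (0 < n)%N) (coprime_mn : coprime m n)
    (r_ge1 : (1 <= r)%N) :
  [/\ connected [set: SL_charvar R r n m],
      connected [set: GL_charvar R r n m] &
      connected [set: PGL_charvar R r n m]].
Proof.
split; apply: charvar_connected => f fr fi.
- exact: (SL_idempotent_const n_gt0 m_gt0 coprime_mn r_ge1 fr fi).
- exact: (GL_idempotent_const n_gt0 m_gt0 coprime_mn r_ge1 fr fi).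
- exact: (PGL_idempotent_const n_gt0 m_gt0 coprime_mn r_ge1 fr fi).
Qed.
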